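(* Let $(X,d)$ be a complete regular semimetric space. Then a subset of $X$ is compact if and only if it is closed and totally bounded.
   Context: $\mathbb{R}_+=[0,\infty)$. A semimetric space $(X,d)$ is a nonempty set $X$ with a symmetric function $d:X\times X\to\mathbb{R}_+$ such that $d(x,y)=0$ if and only if $x=y$ (no triangle inequality is assumed). A triangle function for $d$ is a symmetric function $\Phi:\mathbb{R}_+^2\to[0,\infty]$, monotone increasing (in the weak sense) in both arguments, with $\Phi(0,0)=0$ and $d(x,y)\le\Phi(d(x,z),d(z,y))$ for all $x,y,z\in X$. The space $(X,d)$ is regular if it admits a triangle function that is continuous at $(0,0)$. A sequence $(x_n)$ converges to $x$ if $d(x_n,x)\to0$; it is Cauchy if for every $\varepsilon>0$ there is $n_0$ with $d(x_n,x_m)<\varepsilon$ for $n,m\ge n_0$; the space is complete if every Cauchy sequence converges. The ball is $\mathscr{B}(p,r)=\{x\in X: d(x,p)<r\}$. A set $A\subseteq X$ is open if for every $p\in A$ there is $r>0$ with $\mathscr{B}(p,r)\subseteq A$; the open sets form a topology on $X$ (balls need not be open), and closed sets are complements of open sets. A set $H$ is compact if every cover of $H$ by open sets has a finite subcover. A set $H\subseteq X$ is totally bounded if for every $\varepsilon>0$ there is a finite set $\{p_1,\dots,p_n\}\subseteq X$ with $H\subseteq\bigcup_{i=1}^n\mathscr{B}(p_i,\varepsilon)$. *)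

(* Defs.v *)
From HB Require Import structures.
From mathcomp Require Import all_boot all_order all_algebra.
From mathcomp Require Import all_classical all_reals all_analysis.

Set Implicit Arguments.
Unset Strict Implicit.
Unset Printing Implicit Defensive.

Import Order.TTheory GRing.Theory Num.Theory.
Import numFieldNormedType.Exports.

Local Open Scope classical_set_scope.
Local Open Scope ring_scope.

Record semimetricSpace (R : realType) := SemimetricSpace {
  semimetric_sort :> Type;
  sdist : semimetric_sort -> semimetric_sort -> R;
  semimetric_inhabited : inhabited semimetric_sort;
  sdist_ge0 : forall x y, 0 <= sdist x y;
  sdist_sym : forall x y, sdist x y = sdist y x;
  sdist_eq0 : forall x y, sdist x y = 0 <-> x = y
}.

(* [Phi] stands for a function on [0, +oo[ ^ 2 with values in [0, +oo]: its
   values at pairs with a negative component are never constrained. *)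
Definition triangle_function (R : realType) (X : semimetricSpace R)
    (Phi : R -> R -> \bar R) : Prop :=
  [/\ forall s t, 0 <= s -> 0 <= t -> (0 <= Phi s t)%E,
      forall s t, 0 <= s -> 0 <= t -> Phi s t = Phi t s,
      (forall s s' t, 0 <= s -> s <= s' -> 0 <= t ->
         (Phi s t <= Phi s' t)%E) /\
      (forall s t t', 0 <= s -> 0 <= t -> t <= t' ->
         (Phi s t <= Phi s t')%E),
      Phi 0 0 = 0%E &
      forall x y z : X, ((sdist x y)%:E <= Phi (sdist x z) (sdist z y))%E].

Definition quadrant (R : realType) : set (R * R) :=
  [set u | 0 <= u.1 /\ 0 <= u.2].

Definition regular_semimetric (R : realType) (X : semimetricSpace R) : Prop :=
  exists2 Phi : R -> R -> \bar R, triangle_function X Phi &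
    Phi u.1 u.2 @[u --> within (@quadrant R) (nbhs ((0, 0) : R * R))]
      --> Phi 0 0.

Definition sball (R : realType) (X : semimetricSpace R) (p : X) (r : R) :
    set X :=
  [set x | sdist x p < r].

(* Convergence and Cauchy sequences refer to [sdist], not to the topology
   generated by it. *)
Definition sconverges (R : realType) (X : semimetricSpace R) (u : nat -> X)
    (x : X) : Prop :=
  sdist (u n) x @[n --> \oo] --> (0 : R).

Definition scauchy (R : realType) (X : semimetricSpace R) (u : nat -> X) :
    Prop :=
  forall e : R, 0 < e -> exists n0 : nat,
    forall n m : nat, (n0 <= n)%N -> (n0 <= m)%N -> sdist (u n) (u m) < e.

Definition complete_semimetric (R : realType) (X : semimetricSpace R) : Prop :=
  forall u : nat -> X, scauchy u -> exists x : X, sconverges u x.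

Definition totally_bounded_semimetric (R : realType) (X : semimetricSpace R)
    (H : set X) : Prop :=
  forall e : R, 0 < e ->
    exists2 P : set X, finite_set P & H `<=` \bigcup_(p in P) sball p e.

Definition sopen (R : realType) (X : semimetricSpace R) : set (set X) :=
  [set A | forall p, A p -> exists2 r : R, 0 < r & sball p r `<=` A].

Section SemimetricTopology.
Context (R : realType) (X : semimetricSpace R).

Lemma sopenT : sopen (X := X) setT.
Proof. by move=> p _; exists 1. Qed.

Lemma sopenI : setI_closed (sopen (X := X)).
Proof.
move=> A B oA oB p [/oA[r r0 rA] /oB[s s0 sB]].
exists (Num.min r s); first by rewrite lt_min r0.
by move=> x; rewrite /sball /= lt_min => /andP[xr xs]; split;
  [exact: rA|exact: sB].
Qed.

Lemma sopen_bigU (I : Type) (f : I -> set X) :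
  (forall i, sopen (f i)) -> sopen (\bigcup_i f i).
Proof.
move=> of_ p [i _ /of_[r r0 rf]]; exists r => // x /rf fx; by exists i.
Qed.

HB.instance Definition _ := gen_eqMixin (semimetric_sort X).
HB.instance Definition _ := gen_choiceMixin (semimetric_sort X).
(* The topology attached to every semimetric space; [open], [closed] and
   [cover_compact] on [X] refer to it. *)
HB.instance Definition _ :=
  isOpenTopological.Build (semimetric_sort X) sopenT sopenI sopen_bigU.

Lemma open_sopen (A : set X) : open A = sopen A.
Proof. by []. Qed.

Lemma closed_sopenC (A : set X) : closed A <-> sopen (~` A).
Proof. by rewrite -open_sopen openC. Qed.

End SemimetricTopology.

(* Main.v *)
Require Import Defs.
From HB Require Import structures.
From mathcomp Require Import all_boot all_order all_algebra.
From mathcomp Require Import all_classical all_reals all_analysis.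

(* Continuity of a triangle function at (0, 0) gives a uniform weak triangle
   inequality: d(x, z), d(z, y) < delta implies d(x, y) < e. Hence balls are
   neighbourhoods of their centres, the topology is Hausdorff, and an ultrafilter
   containing a totally bounded set contains a ball of every radius; the centres
   of these balls form a Cauchy sequence whose limit is the limit of the
   ultrafilter. *)

Import Order.TTheory GRing.Theory Num.Theory.
Import numFieldNormedType.Exports.

Local Open Scope classical_set_scope.
Local Open Scope ring_scope.

(** [compact_cover] is stated for pointed spaces; [x] serves as the base point, on which neither
    side depends. *)
Lemma compact_coverE (T : topologicalType) (x : T) (A : set T) :
  compact A <-> cover_compact A.
Proof.
pose pT : ptopologicalType := HB.pack (T : Type) T (isPointed.Build T x).
by have -> : compact A = cover_compact A := congr1 (@^~ A) (compact_cover pT).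
Qed.

Lemma ultra_bigcup (T I : Type) (F : set_system T) (P : set I)
    (f : I -> set T) : UltraFilter F -> finite_set P ->
  F (\bigcup_(i in P) f i) -> exists2 i, P i & F (f i).
Proof.
move=> FU finP FP; apply: contrapT => nF.
have FC : F (\bigcap_(i in P) ~` f i).
  (* Passing from [P] to a finite set of type [fset] requires a choice structure on [I]. *)
  elim/Pchoice: I => I in P f finP FP nF *.
  rewrite -(fset_setK finP); apply: filter_bigI => i; rewrite in_fset_set//.
  rewrite inE => Pi.
  by have [Ff|//] := in_ultra_setVsetC (f i) FU; case: nF; exists i.
by have [y [[i Pi fiy] /(_ i Pi)]] := filter_ex (filterI FP FC).
Qed.

Section RegularSemimetric.
Variables (R : realType) (X : semimetricSpace R).
Hypothesis regX : regular_semimetric X.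

Lemma sdistxx (x : X) : sdist x x = 0.
Proof. exact/sdist_eq0. Qed.

Lemma weak_triangle (e : R) : 0 < e -> exists2 r : R, 0 < r &
  forall x y z : X, sdist x z < r -> sdist z y < r -> sdist x y < e.
Proof.
move=> e0; have [Phi [Phi0 _ _ Phi00 Phid] cPhi] := regX.
have : nbhs (Phi 0 0) [set u | (u < e%:E)%E].
  rewrite Phi00; apply: open_nbhs_nbhs.
  by split; [exact: open_ereal_lt_ereal|rewrite /= lte_fin].
move=> /cPhi /nbhs_ballP[r /= r0 rP]; exists r => // x y z xz zy.
rewrite -lte_fin; apply: le_lt_trans (Phid x y z) _.
apply: (rP (sdist x z, sdist z y)); last by split; exact: sdist_ge0.
by split => /=; rewrite /ball/= sub0r normrN ger0_norm// sdist_ge0.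
Qed.

(** A ball need not be open, so the witness is the set of points having some ball inside
    [sball p r]. It is open: if [t] is a weak triangle radius for [s], each [y] in [sball x t]
    satisfies [sball y t]<=[sball x s]. *)
Lemma nbhs_sball (p : X) (r : R) : 0 < r -> nbhs p (sball p r).
Proof.
move=> r0; rewrite nbhsE.
exists [set x | exists2 s : R, 0 < s & sball x s `<=` sball p r]; last first.
  by move=> x [s s0]; apply; rewrite /sball/= sdistxx.
split; last by exists r.
rewrite open_sopen => x [s s0 xs]; have [t t0 tT] := weak_triangle s s0.
exists t => // y yx; exists t => // z zy; apply: xs.
exact: tT zy yx.
Qed.

Lemma nbhs_sballP (p : X) (A : set X) :
  nbhs p A <-> exists2 r : R, 0 < r & sball p r `<=` A.
Proof.
split=> [|[r r0 rA]]; last exact: filterS rA (nbhs_sball p r r0).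
rewrite nbhsE => -[B [oB Bp] BA]; have [r r0 rB] := oB p Bp.
by exists r => //; exact: subset_trans BA.
Qed.

Lemma semimetric_hausdorff : hausdorff_space X.
Proof.
move=> p q pq; apply/sdist_eq0/eqP; rewrite eq_le sdist_ge0 andbT leNgt.
(* With [sdist p q] itself as the bound, a common point of the two balls of radius [r] would give
   [sdist p q < sdist p q]. *)
apply/negP => e0; have [r r0 rT] := weak_triangle _ e0.
have [z [zp zq]] := pq _ _ (nbhs_sball p r r0) (nbhs_sball q r r0).
by have := rT p q z; rewrite ltxx sdist_sym => /(_ zp zq).
Qed.

Lemma cover_compact_totally_bounded (H : set X) :
  cover_compact H -> totally_bounded_semimetric H.
Proof.
move=> cH e e0.
(* The cover consists of interiors of balls; each still contains its centre. *)
have [|x _|D' _ HD'] := cH X setT (fun p : X => (sball p e)°).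
- by move=> p _; exact: open_interior.
- by exists x => //; exact: nbhs_sball.
apply: (ex_intro2 _ _ _ (finite_fset D')).
by move=> x /HD'[p Dp /interior_subset px]; exists p.
Qed.

Lemma complete_ultra_cvg (H : set X) (F : set_system X) :
  complete_semimetric X -> totally_bounded_semimetric H ->
  UltraFilter F -> F H -> exists x : X, F --> x.
Proof.
move=> complX tbH FU FH.
have /choice[u Fu] : forall n : nat, exists p : X, F (sball p n.+1%:R^-1).
  move=> n; have [|P finP HP] := tbH n.+1%:R^-1; first by rewrite invr_gt0.
  by have [p _ Fp] := ultra_bigcup _ _ F P _ FU finP (filterS HP FH); exists p.
have small (r : R) : 0 < r -> exists n0 : nat, forall n : nat, (n0 <= n)%N ->
    n.+1%:R^-1 < r.
  move=> r0; have [n0 _ n0r] := near_infty_natSinv_lt (PosNum r0).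
  by exists n0 => n /n0r.
have [|x ux] := complX u.
  move=> e /weak_triangle[r r0 rT]; have [n0 n0r] := small r r0.
  exists n0 => n m nn nm.
  (* Two balls belonging to [F] meet, and a common point links their centres. *)
  have [z [zn zm]] := filter_ex (filterI (Fu n) (Fu m)).
  apply: (rT _ _ z); last exact: lt_trans zm (n0r m nm).
  by rewrite sdist_sym; exact: lt_trans zn (n0r n nn).
exists x => A /nbhs_sballP[e /weak_triangle[r r0 rT] eA].
have [n0 n0r] := small r r0.
have [n1 _ n1r] := cvgr0_norm_lt _ ux r r0.
(* For this [n], both the radius of the ball around [u n] and the distance from [u n] to [x] are
   below [r], so that ball lies in [sball x e]. *)
pose n := maxn n0 n1; apply: filterS (Fu n) => y yn; apply: eA.
apply: rT (lt_trans yn (n0r _ (leq_maxl _ _))) _.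
by have := n1r n (leq_maxr _ _); rewrite /= ger0_norm// sdist_ge0.
Qed.

End RegularSemimetric.

Theorem theorem4 (R : realType) (X : semimetricSpace R)
    (complX : complete_semimetric X) (regX : regular_semimetric X)
    (H : set X) :
  cover_compact H <-> closed H /\ totally_bounded_semimetric H.
Proof.
have [x0] := semimetric_inhabited X.
split=> [cH|[clH tbH]].
  split; last exact: cover_compact_totally_bounded.
  apply: compact_closed; first exact: semimetric_hausdorff.
  exact/(compact_coverE _ x0).
apply/(compact_coverE _ x0); rewrite compact_ultra => F FU FH.
have [x Fx] := complete_ultra_cvg _ _ regX _ _ complX tbH FU FH.
(* The limit is in the closure of [H]: each of its neighbourhoods belongs to [F], as does [H], so
   they meet. *)
exists x; split=> //; apply: clH => B /Fx FB.
exact: filter_ex (filterI FH FB).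
Qed.
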